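(* Let $\lambda$ be a nonzero real number, and let $(a_{k,n}(x|\lambda))_{k,n\ge 0}$ be the degenerate Euler-Seidel matrix with initial sequence $a_{0,n}(x|\lambda)=L_{n,\lambda}(x)$, $n\ge 0$. Then $$\sum_{n=0}^{\infty}a_{n,0}(x|\lambda)\frac{t^n}{n!}=e_\lambda^{1-\lambda}(t)\,e_\lambda^x\left(\frac{t}{(1-t)^2}\right)$$ as formal power series in $t$, and for all $n\ge 0$, $$a_{n,0}(x|\lambda)=\sum_{k=0}^{n}\binom{n}{k}(1-\lambda)_{n-k,\lambda}L_{k,\lambda}(x).$$
   Context: $x$ is an indeterminate over the real numbers. For nonzero real $\lambda$, $(y)_{0,\lambda}=1$ and $(y)_{k,\lambda}=y(y-\lambda)(y-2\lambda)\cdots(y-(k-1)\lambda)$ for $k\ge 1$. The degenerate exponential is the formal power series $e_\lambda^y(t)=\sum_{k=0}^{\infty}(y)_{k,\lambda}\frac{t^k}{k!}$. For $n\ge 0$, $K_{n,\lambda}(x)=n!\sum_{k=0}^{n}\binom{n+k+1}{n-k}\frac{(x)_{k,\lambda}}{k!}$; $J_{n,\lambda}(x)=K_{n,\lambda}(x)-nK_{n-1,\lambda}(x)$; and $L_{n,\lambda}(x)=J_{n,\lambda}(x)-nJ_{n-1,\lambda}(x)$, where for $n=0$ the second terms are read as $0$, so $J_{0,\lambda}(x)=L_{0,\lambda}(x)=1$. The degenerate Euler-Seidel matrix with a given initial sequence $(a_{0,n}(x|\lambda))_{n\ge 0}$ is determined by $a_{k,n}(x|\lambda)=(1-(k-n)\lambda)a_{k-1,n}(x|\lambda)+a_{k-1,n+1}(x|\lambda)$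 for $k\ge 1$, $n\ge 0$. *)

(* Defs.v *)
From HB Require Import structures.
From mathcomp Require Export all_boot all_order all_algebra.
From mathcomp Require Export reals.
From mathcomp Require Import boolp.

Set Implicit Arguments.
Unset Strict Implicit.
Unset Printing Implicit Defensive.

Import GRing.Theory.
Local Open Scope ring_scope.

(* Formal power series over a commutative ring A, as sequences of            *)
(* coefficients, with the Cauchy product. They are wrapped in a record so    *)
(* that the product does not clash with the pointwise one on functions.      *)
Record fps (A : Type) := FPS { fps_coef : nat -> A }.

Lemma fpsP (A : Type) (f g : fps A) : fps_coef f =1 fps_coef g -> f = g.
Proof. by case: f g => [f] [g] /= /funext ->. Qed.

HB.instance Definition _ (A : Type) := gen_eqMixin (fps A).
HB.instance Definition _ (A : Type) := gen_choiceMixin (fps A).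

Section FpsRing.
Variable A : comNzRingType.
Implicit Types f g h : fps A.

Definition fps_zero : fps A := FPS (fun=> 0).
Definition fps_opp f : fps A := FPS (fun n => - fps_coef f n).
Definition fps_add f g : fps A := FPS (fun n => fps_coef f n + fps_coef g n).
Definition fps_one : fps A := FPS (fun n => (n == 0%N)%:R).
Definition fps_mul f g : fps A :=
  FPS (fun n => \sum_(i < n.+1) fps_coef f i * fps_coef g (n - i)%N).

Fact fps_addA : associative fps_add.
Proof. by move=> f g h; apply: fpsP => n /=; rewrite addrA. Qed.
Fact fps_addC : commutative fps_add.
Proof. by move=> f g; apply: fpsP => n /=; rewrite addrC. Qed.
Fact fps_add0 : left_id fps_zero fps_add.
Proof. by move=> f; apply: fpsP => n /=; rewrite add0r. Qed.
Fact fps_addN : left_inverse fps_zero fps_opp fps_add.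
Proof. by move=> f; apply: fpsP => n /=; rewrite addNr. Qed.

HB.instance Definition _ :=
  GRing.isZmodule.Build (fps A) fps_addA fps_addC fps_add0 fps_addN.

Let trunc n f : {poly A} := \poly_(i < n.+1) fps_coef f i.

Let trunc_coef n f i : (i <= n)%N -> (trunc n f)`_i = fps_coef f i.
Proof. by move=> le_in; rewrite coef_poly ltnS le_in. Qed.

Let mul_coef_trunc n f g (p q : {poly A}) :
  (forall i, (i <= n)%N -> p`_i = fps_coef f i) ->
  (forall i, (i <= n)%N -> q`_i = fps_coef g i) ->
  forall i, (i <= n)%N -> (p * q)`_i = fps_coef (fps_mul f g) i.
Proof.
move=> Hp Hq i le_in; rewrite coefM; apply: eq_bigr => j _.
have le_ji : (j <= i)%N by rewrite -ltnS.
by rewrite Hp ?Hq // (leq_trans _ le_in) // leq_subr.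
Qed.

Fact fps_mulA : associative fps_mul.
Proof.
move=> f g h; apply: fpsP => n.
have T k i : (i <= n)%N -> (trunc n k)`_i = fps_coef k i by apply: trunc_coef.
rewrite -(mul_coef_trunc (T f) (mul_coef_trunc (T g) (T h)) (leqnn n)).
by rewrite -(mul_coef_trunc (mul_coef_trunc (T f) (T g)) (T h) (leqnn n)) mulrA.
Qed.

Fact fps_mulC : commutative fps_mul.
Proof.
move=> f g; apply: fpsP => n.
have T k i : (i <= n)%N -> (trunc n k)`_i = fps_coef k i by apply: trunc_coef.
rewrite -(mul_coef_trunc (T f) (T g) (leqnn n)) mulrC.
by rewrite -(mul_coef_trunc (T g) (T f) (leqnn n)).
Qed.

Fact fps_mul1 : left_id fps_one fps_mul.
Proof.
move=> f; apply: fpsP => n /=.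
rewrite big_ord_recl /= subn0 mul1r big1 ?addr0 // => i _.
by rewrite mul0r.
Qed.

Fact fps_mulDl : left_distributive fps_mul fps_add.
Proof.
move=> f g h; apply: fpsP => n /=; rewrite -big_split /=.
by apply: eq_bigr => i _; rewrite mulrDl.
Qed.

Fact fps_one_neq0 : fps_one != 0.
Proof.
by apply/eqP => /(congr1 (fun f => fps_coef f 0%N)) /= /eqP; rewrite oner_eq0.
Qed.

HB.instance Definition _ := GRing.Zmodule_isComNzRing.Build (fps A)
  fps_mulA fps_mulC fps_mul1 fps_mulDl fps_one_neq0.

Definition fpsX : fps A := FPS (fun n => (n == 1%N)%:R).

(* The composition g(f(t)), meaningful only when f has no constant term:     *)
(* then (f ^+ k) has order at least k, so the coefficient of t^n in          *)
(* \sum_k g_k f^k only involves the terms k <= n.                            *)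
Definition fps_comp g f : fps A :=
  FPS (fun n => \sum_(k < n.+1) fps_coef g k * fps_coef (f ^+ k) n).

End FpsRing.

Section FpsUnitRing.
Variable A : comUnitRingType.
Implicit Types f g : fps A.

Definition fps_unit : {pred fps A} := fun f => fps_coef f 0%N \is a GRing.unit.

(* The first n coefficients of 1 / f, by the usual recursion.                *)
Fixpoint fps_inv_seq f (n : nat) : seq A :=
  if n is m.+1 then
    let s := fps_inv_seq f m in
    rcons s ((fps_coef f 0%N)^-1 *
             ((m == 0%N)%:R - \sum_(i < m) s`_i * fps_coef f (m - i)%N))
  else [::].

(* As for the other unit rings of the library, non-units are their own       *)
(* conventional inverse.                                                     *)
Definition fps_inv f : fps A :=
  if f \in fps_unit then FPS (fun n => (fps_inv_seq f n.+1)`_n) else f.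

Let size_inv_seq f n : size (fps_inv_seq f n) = n.
Proof. by elim: n => //= n IHn; rewrite size_rcons IHn. Qed.

Let nth_inv_seq f n i :
  (i < n)%N -> (fps_inv_seq f n)`_i = (fps_inv_seq f i.+1)`_i.
Proof.
elim: n => // n IHn; rewrite ltnS leq_eqVlt => /orP[/eqP -> //|lt_in].
by rewrite -IHn // [in LHS]/= nth_rcons size_inv_seq lt_in.
Qed.

Let inv_coefE f n : (fps_inv_seq f n.+1)`_n = (fps_coef f 0%N)^-1 *
  ((n == 0%N)%:R - \sum_(i < n) (fps_inv_seq f i.+1)`_i * fps_coef f (n - i)%N).
Proof.
rewrite [in LHS]/= nth_rcons size_inv_seq ltnn eqxx; congr (_ * (_ - _)).
by apply: eq_bigr => i _; rewrite nth_inv_seq.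
Qed.

Fact fps_mulVx : {in fps_unit, left_inverse 1 fps_inv *%R}.
Proof.
move=> f Uf; apply: fpsP => n; rewrite /fps_inv Uf.
transitivity (\sum_(i < n) (fps_inv_seq f i.+1)`_i * fps_coef f (n - i)%N
              + (fps_inv_seq f n.+1)`_n * fps_coef f 0%N).
  by rewrite [LHS]big_ord_recr /= subnn.
by rewrite inv_coefE mulrC mulrA mulrV // mul1r addrC subrK.
Qed.

Fact fps_unitPl f g : g * f = 1 -> f \in fps_unit.
Proof.
move=> /(congr1 (fun h => fps_coef h 0%N)) /=.
rewrite big_ord_recl big_ord0 addr0 subnn /= => gf1.
by apply/unitrPr; exists (fps_coef g 0%N); rewrite mulrC.
Qed.

Fact fps_inv_out : {in [predC fps_unit], fps_inv =1 id}.
Proof. by move=> f; rewrite inE /fps_inv => /negbTE ->. Qed.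

HB.instance Definition _ := GRing.ComNzRing_hasMulInverse.Build (fps A)
  fps_mulVx fps_unitPl fps_inv_out.

End FpsUnitRing.

(* The indeterminate x is 'X : {poly R}, and all the quantities below are    *)
(* polynomials in x with real coefficients; the variable t of the power      *)
(* series in {poly R}[[t]] is fpsX.                                          *)
Section Degenerate.
Variables (R : realType) (lam : R).

Definition degen_ffact (y : {poly R}) (k : nat) : {poly R} :=
  \prod_(i < k) (y - (i%:R * lam)%:P).

Definition degen_exp (y : {poly R}) : fps {poly R} :=
  FPS (fun k => k`!%:R^-1 *: degen_ffact y k).

Definition K_poly (n : nat) : {poly R} :=
  n`!%:R *: \sum_(k < n.+1)
    ('C(n + k + 1, n - k)%:R / k`!%:R) *: degen_ffact 'X k.

Definition J_poly (n : nat) : {poly R} :=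
  if n is m.+1 then K_poly n - n%:R *: K_poly m else K_poly 0.

Definition L_poly (n : nat) : {poly R} :=
  if n is m.+1 then J_poly n - n%:R *: J_poly m else J_poly 0.

(* The subtraction k - n is the signed one, performed in R.                  *)
Fixpoint euler_seidel (a0 : nat -> {poly R}) (k n : nat) : {poly R} :=
  if k is k'.+1 then
    (1 - (k%:R - n%:R) * lam) *: euler_seidel a0 k' n
      + euler_seidel a0 k' n.+1
  else a0 n.

End Degenerate.

Definition egf (R : realType) (u : nat -> {poly R}) : fps {poly R} :=
  FPS (fun n => n`!%:R^-1 *: u n).

(* Main.v *)
Require Import Defs.
From mathcomp Require Import ring zify.

Import GRing.Theory.
Local Open Scope ring_scope.

(** The two claims are linked by a closed form for the whole matrix,
      a_(k,n) = \sum_j 'C(k, j) (1 - lam + n lam)_(k-j) a_(0,n+j),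
    where (y)_m is the degenerate falling factorial of step lam
    ([euler_seidel_closed_form]). It holds for every initial sequence: one step
    of the recurrence amounts to a Pascal rule for degenerate falling
    factorials ([degen_ffact_Pascal]), in which increasing n by one replaces
    the base point y by y + lam. At n = 0 this is the second claim, and it says
    that the exponential generating function of the first column is
    e^(1-lam)(t) times that of the first row ([egf_binomial_conv]), e^y being
    the degenerate exponential.

    It remains to see that the first row L has generating function
    e^x(t / (1-t)^2). Passing from K to J and from J to L multiplies generating
    functions by 1 - t ([egf_sub_shift]), so that of L is (1-t)^2 times that of
    K, and the latter is \sum_k (x)_k / k! G_k with
    G_k = \sum_n 'C(n+k+1, 2k+1) t^n. As G_k = t^k / (1-t)^(2k+2), the factor
    (1-t)^2 turns G_k into (t / (1-t)^2)^k ([mul_diag_bin_fps]). *)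

(** * Power series multiplied by t and by 1 - t *)

Section FpsCoefficients.
Set Implicit Arguments.
Unset Strict Implicit.
Variable A : comNzRingType.
Implicit Types f g : fps A.

Lemma fps_coefM f g n :
  fps_coef (f * g) n = \sum_(i < n.+1) fps_coef f i * fps_coef g (n - i)%N.
Proof. by []. Qed.

Lemma fps_coefB f g n : fps_coef (f - g) n = fps_coef f n - fps_coef g n.
Proof. by []. Qed.

Lemma coef_fpsXM0 f : fps_coef (fpsX A * f) 0 = 0.
Proof. by rewrite fps_coefM big_ord_recl big_ord0 /= mul0r addr0. Qed.

Lemma coef_fpsXMS f n : fps_coef (fpsX A * f) n.+1 = fps_coef f n.
Proof.
rewrite fps_coefM 2!big_ord_recl /= mul0r add0r mul1r subSS subn0.
by rewrite big1 ?addr0 // => i _; rewrite mul0r.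
Qed.

Lemma coef_subXM0 f : fps_coef ((1 - fpsX A) * f) 0 = fps_coef f 0.
Proof. by rewrite mulrBl mul1r fps_coefB coef_fpsXM0 subr0. Qed.

Lemma coef_subXMS f n :
  fps_coef ((1 - fpsX A) * f) n.+1 = fps_coef f n.+1 - fps_coef f n.
Proof. by rewrite mulrBl mul1r fps_coefB coef_fpsXMS. Qed.

(** For a family with [G k] of order at least [k], the sum of the
    [c k * G k]; the cut at [k <= n] then loses nothing. Composition is the
    case where [G k] is the k-th power of a series without constant term. *)
Definition fps_series (c : nat -> A) (G : nat -> fps A) : fps A :=
  FPS (fun n => \sum_(k < n.+1) c k * fps_coef (G k) n).

Lemma fps_series_mul h (c : nat -> A) (G : nat -> fps A) :
  (forall k n, (n < k)%N -> fps_coef (G k) n = 0) ->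
  h * fps_series c G = fps_series c (fun k => h * G k).
Proof.
move=> ordG; apply: fpsP => n; rewrite fps_coefM /=.
(* The inner sums get the common range k <= n before they are exchanged. *)
transitivity (\sum_(i < n.+1) \sum_(k < n.+1)
    c k * (fps_coef h i * fps_coef (G k) (n - i)%N)).
  apply: eq_bigr => i _; rewrite big_distrr /=.
  have le_ni : ((n - i).+1 <= n.+1)%N by rewrite ltnS leq_subr.
  rewrite (big_ord_widen _ (fun k => fps_coef h i *
    (c k * fps_coef (G k) (n - i)%N)) le_ni) big_mkcond /=.
  apply: eq_bigr => k _; rewrite ltnS; case: leqP => [_|lt_k].
    by rewrite mulrCA.
  by rewrite ordG // !mulr0.
by rewrite exchange_big; apply: eq_bigr => k _; rewrite big_distrr.
Qed.

(** * The series of binomial coefficients t^k / (1-t)^(2k+2) *)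

(** Pascal's rule; the hypothesis makes it true of the constant term too. *)
Lemma subX_mul_bin s m : (s <= m)%N ->
  (1 - fpsX A) * FPS (fun n => 'C(n + s.+1, m.+1)%:R)
    = FPS (fun n => 'C(n + s, m)%:R).
Proof.
move=> le_sm; apply: fpsP => -[|n].
  by rewrite coef_subXM0 /= !add0n binS (@bin_small s m.+1) ?ltnS.
by rewrite coef_subXMS /= !addnS !addSn binS natrD addrC addKr.
Qed.

(** The lower index is [2k+1] and not the equivalent [n-k], so that the
    coefficients vanish for [n < k], where the truncated [n - k] would make
    them 1. *)
Definition diag_bin_fps k : fps A := FPS (fun n => 'C(n + k.+1, k.*2.+1)%:R).

Lemma coef_diag_bin_small k n : (n < k)%N -> fps_coef (diag_bin_fps k) n = 0.
Proof. by move=> ltnk; rewrite /= bin_small // -addnn addnS ltnS ltn_add2r. Qed.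

Lemma subX_mul_geometric : (1 - fpsX A) * FPS (fun=> 1) = 1.
Proof.
by apply: fpsP => -[|n]; rewrite (coef_subXM0, coef_subXMS) //= subrr.
Qed.

Lemma subX2_mul_diag_bin0 : (1 - fpsX A) ^+ 2 * diag_bin_fps 0 = 1.
Proof.
rewrite expr2 -mulrA subX_mul_bin // -[RHS]subX_mul_geometric.
by congr (_ * _); apply: fpsP => n; rewrite /= bin0.
Qed.

Lemma subX2_mul_diag_binS k :
  (1 - fpsX A) ^+ 2 * diag_bin_fps k.+1 = fpsX A * diag_bin_fps k.
Proof.
rewrite expr2 -mulrA /diag_bin_fps doubleS.
rewrite subX_mul_bin; last by rewrite -addnn ltnS -addnS leq_addr.
rewrite subX_mul_bin; last by rewrite -addnn -addnS leq_addr.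
apply: fpsP => -[|n]; last by rewrite coef_fpsXMS /= addSnnS.
by rewrite coef_fpsXM0 /= bin_small // -addnn ltnS leq_addr.
Qed.

End FpsCoefficients.

Lemma mul_diag_bin_fps (A : comUnitRingType) k :
  (1 - fpsX A) ^+ 2 * diag_bin_fps A k = (fpsX A / (1 - fpsX A) ^+ 2) ^+ k.
Proof.
have unit_subX : (1 - fpsX A) ^+ 2 \is a GRing.unit.
  by apply/unitrPr; exists (diag_bin_fps A 0); apply: subX2_mul_diag_bin0.
elim: k => [|k IHk]; first exact: subX2_mul_diag_bin0.
by rewrite [RHS]exprS -IHk subX2_mul_diag_binS mulrA mulrVK.
Qed.

(** * Exponential generating functions *)

Section GeneratingFunctions.
Set Implicit Arguments.
Unset Strict Implicit.
Variable R : realType.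

Lemma fact_neq0 n : n`!%:R != 0 :> R.
Proof. by rewrite Num.Theory.pnatr_eq0 -lt0n fact_gt0. Qed.

Lemma egf_binomial_conv (u v : nat -> {poly R}) :
  egf (fun n => \sum_(k < n.+1) (u k * v (n - k)%N) *+ 'C(n, k))
    = egf u * egf v.
Proof.
apply: fpsP => n; rewrite fps_coefM /= scaler_sumr; apply: eq_bigr => k _.
have le_kn : (k <= n)%N by rewrite -ltnS.
rewrite -scalerAl -scalerAr scalerA -scaler_nat scalerA; congr (_ *: _).
rewrite -(bin_fact le_kn) !natrM.
have bin_neq0 : 'C(n, k)%:R != 0 :> R.
  by rewrite Num.Theory.pnatr_eq0 -lt0n bin_gt0.
by field; rewrite bin_neq0 !fact_neq0.
Qed.

Lemma egf_sub_shift (u v : nat -> {poly R}) :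
  v 0%N = u 0%N -> (forall n, v n.+1 = u n.+1 - n.+1%:R *: u n) ->
  egf v = (1 - fpsX {poly R}) * egf u.
Proof.
move=> v0 vS; apply: fpsP => -[|n]; first by rewrite coef_subXM0 /= v0.
rewrite coef_subXMS /= vS scalerBr scalerA; congr (_ - _ *: _).
rewrite factS natrM.
have nS_neq0 : n.+1%:R != 0 :> R by rewrite Num.Theory.pnatr_eq0.
by field; rewrite addrC natr1 nS_neq0 fact_neq0.
Qed.

Variable lam : R.

Lemma egf_K_poly :
  egf (K_poly lam)
    = fps_series (fps_coef (degen_exp lam 'X)) (diag_bin_fps {poly R}).
Proof.
apply: fpsP => n; rewrite /= /K_poly scalerA mulVf ?fact_neq0 // scale1r.
apply: eq_bigr => k _.
have le_kn : (k <= n)%N by rewrite -ltnS.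
rewrite -scalerA scaler_nat mulr_natr /=.
congr (_ *+ _); rewrite -bin_sub; last by lia.
by congr 'C(_, _); lia.
Qed.

Lemma egf_L_poly :
  egf (L_poly lam)
    = fps_comp (degen_exp lam 'X) (fpsX {poly R} / (1 - fpsX {poly R}) ^+ 2).
Proof.
rewrite (egf_sub_shift (u := J_poly lam)) //.
rewrite (egf_sub_shift (u := K_poly lam)) //.
rewrite mulrA -expr2 egf_K_poly fps_series_mul; last exact: coef_diag_bin_small.
by apply: fpsP => n; apply: eq_bigr => k _; rewrite mul_diag_bin_fps.
Qed.

(** * The degenerate Euler-Seidel matrix *)

Lemma degen_ffactSr (y : {poly R}) m :
  degen_ffact lam y m.+1 = degen_ffact lam y m * (y - (m%:R * lam)%:P).
Proof. by rewrite /degen_ffact big_ord_recr. Qed.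

Lemma degen_ffact_shift (y : {poly R}) m :
  degen_ffact lam (y + lam%:P) m.+1 = (y + lam%:P) * degen_ffact lam y m.
Proof.
rewrite /degen_ffact big_ord_recl mul0r subr0; congr (_ * _).
apply: eq_bigr => i _; rewrite /= /bump leq0n add1n -natr1.
by rewrite mulrDl mul1r polyCD opprD addrACA subrr addr0.
Qed.

(** For j < k, all three terms are multiples of (y)_m with m = k - j - 1, and
    the cofactors agree because (j + 1) 'C(k, j+1) = (k - j) 'C(k, j). *)
Lemma degen_ffact_Pascal (y : {poly R}) k j : (j <= k)%N ->
  ((y - (k%:R * lam)%:P) * degen_ffact lam y (k - j.+1)) *+ 'C(k, j.+1)
    + degen_ffact lam (y + lam%:P) (k - j) *+ 'C(k, j)
  = degen_ffact lam y (k - j) *+ 'C(k.+1, j.+1).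
Proof.
rewrite leq_eqVlt => /orP[/eqP->|lt_jk].
  by rewrite subnn !binn bin_small // mulr0n add0r /degen_ffact !big_ord0.
have ->: (k - j = (k - j.+1).+1)%N by rewrite subnSK.
have: (j.+1 * 'C(k, j.+1) = (k - j.+1).+1 * 'C(k, j))%N.
  by rewrite subnSK // mul_bin_left.
have: (k = (k - j.+1) + j.+1)%N by rewrite subnK.
move: (k - j.+1)%N => m kE /(congr1 (fun n => n%:R : {poly R})).
rewrite !natrM => binE.
have -> : (k%:R * lam)%:P = (m%:R + j.+1%:R) * lam%:P.
  by rewrite kE polyCM natrD polyCD !polyC_natr.
rewrite degen_ffact_shift degen_ffactSr polyCM polyC_natr binS mulrnDr.
move: (degen_ffact lam y m) (lam%:P) => F l.
rewrite -(mulr_natr ((y - _) * F)) -(mulr_natr ((y + l) * F)).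
rewrite -!(mulr_natr (F * (y - _))).
move: 'C(k, j.+1)%:R 'C(k, j)%:R binE => b c binE.
apply/eqP; rewrite -subr_eq0; apply/eqP.
transitivity (F * l * (m.+1%:R * c - j.+1%:R * b)).
  by rewrite -natr1; ring.
by rewrite binE subrr mulr0.
Qed.

Lemma euler_seidel_closed_form (a0 : nat -> {poly R}) k n :
  euler_seidel lam a0 k n
    = \sum_(j < k.+1)
        (degen_ffact lam (1 - lam + n%:R * lam)%:P (k - j) * a0 (n + j)%N)
          *+ 'C(k, j).
Proof.
elim: k n => [|k IHk] n.
  by rewrite big_ord_recl big_ord0 /= addn0 addr0 /degen_ffact big_ord0 mul1r.
rewrite /= !IHk; set y := (1 - lam + n%:R * lam)%:P.
have -> : (1 - lam + n.+1%:R * lam)%:P = y + lam%:P.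
  by rewrite -polyCD -natr1 mulrDl mul1r addrA.
rewrite -mul_polyC.
have -> : (1 - (k.+1%:R - n%:R) * lam)%:P = y - (k%:R * lam)%:P.
  by rewrite -polyCB -natr1; congr (_%:P); ring.
(* A vanishing term j = k + 1 lets the first sum be shifted like the others. *)
pose T j := (degen_ffact lam y (k - j) * a0 (n + j)%N) *+ 'C(k, j).
have -> : \sum_(j < k.+1) T j = T 0%N + \sum_(j < k.+1) T j.+1.
  transitivity (\sum_(j < k.+2) T j); last by rewrite big_ord_recl.
  by rewrite [RHS]big_ord_recr /= [T k.+1]/T bin_small // mulr0n addr0.
rewrite mulrDr [RHS]big_ord_recl -addrA; congr (_ + _).
  by rewrite /T /= !bin0 !mulr1n subn0 degen_ffactSr mulrCA mulrA.
rewrite big_distrr -big_split; apply: eq_bigr => j _ /=.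
have le_jk : (j <= k)%N by rewrite -ltnS.
rewrite /bump leq0n add1n subSS /T addSnnS.
rewrite -[RHS]mulrnAl -(degen_ffact_Pascal y le_jk).
by rewrite [RHS]mulrDl !mulrnAl mulrnAr mulrA.
Qed.

End GeneratingFunctions.

Theorem mainTheorem12 (R : realType) (lam : R) (hlam : lam != 0) :
  let a := euler_seidel lam (L_poly lam) in
  let t := fpsX {poly R} in
  egf (fun n => a n 0%N)
    = degen_exp lam (1 - lam)%:P
      * fps_comp (degen_exp lam 'X) (t / (1 - t) ^+ 2)
  /\ forall n : nat,
       a n 0%N = \sum_(k < n.+1)
                   (degen_ffact lam (1 - lam)%:P (n - k) * L_poly lam k) *+ 'C(n, k).
Proof.
move=> a t.
have column n : a n 0%N = \sum_(k < n.+1)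
    (degen_ffact lam (1 - lam)%:P (n - k) * L_poly lam k) *+ 'C(n, k).
  by rewrite /a euler_seidel_closed_form mul0r addr0.
split=> //; rewrite -egf_L_poly mulrC.
rewrite -[degen_exp lam _]/(egf (degen_ffact lam (1 - lam)%:P)).
rewrite -egf_binomial_conv; apply: fpsP => n /=; rewrite column.
by congr (_ *: _); apply: eq_bigr => k _; rewrite mulrC.
Qed.
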